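(* Let $M$ be a connected finite simple graph on $p$ vertices and let $\Delta$ be the maximum vertex degree of $M$. Then $$E(M) \leq \frac{p}{2}\,PE(M) \leq \frac{p^2(p-1)\Delta}{2},$$ where $E(M)$ is the energy and $PE(M)$ the path energy of $M$. Moreover, equality holds (in both inequalities) if $M=K_2$.
   Context: The energy $E(M)$ of a finite simple graph $M$ is the sum of the absolute values of the eigenvalues (with multiplicity) of its adjacency matrix. For a finite simple graph $M$ with vertex set $\{v_1,\dots,v_p\}$, the path matrix $P(M)=(p_{i,j})$ is the $p\times p$ real symmetric matrix with $p_{i,i}=0$ and, for $i\neq j$, $p_{i,j}$ equal to the maximum number of vertex disjoint paths from $v_i$ to $v_j$ (i.e. paths that pairwise share no vertices other than the endpoints $v_i,v_j$; an edge $v_iv_j$ counts as one such path). The path eigenvalues of $M$ are the eigenvalues of $P(M)$, and the path energy $PE(M)$ is the sum of the absolute values of the path eigenvalues, counted with multiplicity. $K_2$ is the complete graph on two vertices. *)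

(* Defs.v *)
From mathcomp Require Import all_boot all_order all_algebra.

Set Implicit Arguments.
Unset Strict Implicit.
Unset Printing Implicit Defensive.

Import Order.TTheory GRing.Theory Num.Theory.
Local Open Scope ring_scope.

(* Eigenvalues with algebraic multiplicity: the roots of the characteristic
   polynomial in a numeric algebraically closed field C (e.g. algC, or R[i]
   for a real closed field R); see char_poly_eigenvalues. *)
Definition eigenvalues (C : numClosedFieldType) (n : nat) (A : 'M[C]_n) :
    seq C :=
  sval (closed_field_poly_normal (char_poly A)).

Lemma char_poly_eigenvalues (C : numClosedFieldType) (n : nat) (A : 'M[C]_n) :
  char_poly A = \prod_(z <- eigenvalues A) ('X - z%:P).
Proof.
rewrite /eigenvalues; case: closed_field_poly_normal => r /= def_r.
by rewrite {1}def_r (monicP (char_poly_monic A)) scale1r.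
Qed.

Definition mx_energy (C : numClosedFieldType) (n : nat) (A : 'M[C]_n) : C :=
  \sum_(z <- eigenvalues A) `|z|.

Section Graph.

Variables (T : finType) (e : rel T).

Definition simple_graph : Prop := symmetric e /\ irreflexive e.

Definition connected_graph : Prop := forall x y : T, connect e x y.

Definition degree (x : T) : nat := #|[set y | e x y]|.

Definition max_degree : nat := \max_(x : T) degree x.

Definition is_K2 : Prop := #|T| = 2%N /\ forall x y : T, e x y = (x != y).

(* The path with vertex sequence x :: s.  As it repeats no vertex,
   s has size less than #|T|. *)
Definition path_between (x y : T) (s : seq T) : bool :=
  [&& path e x s, last x s == y & uniq (x :: s)].

(* F is a set, so the edge between x and y (s = [:: y]), the only path without
   internal vertices, is counted at most once. *)
Definition disjoint_paths (x y : T) (F : {set #|T|.-bseq T}) : bool :=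
  [forall s in F, path_between x y s] &&
  [forall s in F, forall t in F, (s != t) ==>
     [forall z, (z \in x :: s) && (z \in x :: t) ==> (z \in [:: x; y])]].

Definition max_disjoint_paths (x y : T) : nat :=
  \max_(F : {set #|T|.-bseq T} | disjoint_paths x y F) #|F|.

Variable C : numClosedFieldType.

Definition adjacency_mx : 'M[C]_#|T| :=
  \matrix_(i, j) (e (enum_val i) (enum_val j))%:R.

Definition path_mx : 'M[C]_#|T| :=
  \matrix_(i, j)
    (if i == j then 0%N else max_disjoint_paths (enum_val i) (enum_val j))%:R.

Definition graph_energy : C := mx_energy adjacency_mx.

Definition path_energy : C := mx_energy path_mx.

End Graph.

(* Main.v *)
(** With F(M) the sum of the squared entries of M, the spectral theorem gives
    F(M) = sum |lambda|^2 for a real symmetric M of order p, so Cauchy-Schwarz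
    yields energy(M)^2 <= p F(M). When M has zero diagonal the eigenvalues sum
    to 0, and this sharpens energy(M)^2 >= F(M) to energy(M)^2 >= 2 F(M).
    Entrywise, adjacency <= path <= Delta off the diagonal, hence
    E^2 <= p F(A) <= p F(P) <= p PE^2 / 2 and PE^2 <= p^2 (p - 1) Delta^2,
    which suffices for p >= 2; for p <= 1 everything vanishes. *)
Require Import Defs.
From mathcomp Require Import all_boot all_order all_algebra.
From mathcomp Require Import ring.

Set Implicit Arguments.
Unset Strict Implicit.
Unset Printing Implicit Defensive.

Import Order.TTheory GRing.Theory Num.Theory.
Local Open Scope ring_scope.
Local Open Scope sesquilinear_scope.

(** * Energy, trace and Frobenius norm of a normal matrix *)

(** The scalar matrix of the indeterminate is central, so the characteristic matrix factors over
    polynomials as the inverse of [P], times that of [D], times [P]; the outer determinants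
    cancel. *)
Lemma char_poly_conjugate (R : comUnitRingType) n (P D : 'M[R]_n) :
  P \in unitmx -> char_poly (invmx P *m D *m P) = char_poly D.
Proof.
move=> Punit; rewrite /char_poly /char_poly_mx !map_mxM.
set Pi := map_mx polyC (invmx P); set Q := map_mx polyC P.
have PiQ : Pi *m Q = 1%:M by rewrite -map_mxM mulVmx // map_mx1.
rewrite -[X in X - _]mulmx1 -PiQ mulmxA -scalar_mxC -mulmxBl -mulmxBr.
by rewrite !det_mulmx mulrAC -det_mulmx PiQ det1 mul1r.
Qed.

Section NormalMatrices.

Variables (C : numClosedFieldType) (n : nat) (A : 'M[C]_n).
Hypothesis normalA : A \is normalmx.

Let d i := spectral_diag A 0 i.

Let spectralA :
  A = invmx (spectralmx A) *m diag_mx (spectral_diag A) *m spectralmx A.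
Proof. exact/orthomx_spectralP. Qed.

(** The list [eigenvalues A] comes in an unspecified order; unique factorization of the
    characteristic polynomial into linear factors matches it with the spectral diagonal up to
    permutation. *)
Lemma mx_energy_normal : mx_energy A = \sum_i `|d i|.
Proof.
have /(perm_big _) eq_ev : perm_eq (eigenvalues A) [seq d i | i <- enum 'I_n].
  apply: prod_XsubC_eq; rewrite -char_poly_eigenvalues big_map big_enum /=.
  rewrite {1}spectralA char_poly_conjugate ?spectral_unit //.
  rewrite char_poly_trig ?diag_mx_is_trig //.
  by apply: eq_bigr => i _; rewrite !mxE eqxx mulr1n.
by rewrite /mx_energy eq_ev big_map big_enum.
Qed.

Lemma mxtrace_normal : \tr A = \sum_i d i.
Proof.
by rewrite {1}spectralA -mulmxA mxtrace_mulC mulmxK ?spectral_unit ?mxtrace_diag.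
Qed.

(** Both sides are the trace of [A *m A^t*], which is invariant under the unitary change of basis
    that diagonalizes [A]. *)
Lemma frobenius_normal :
  \sum_i \sum_j `|A i j| ^+ 2 = \sum_i `|d i| ^+ 2.
Proof.
have -> : \sum_i \sum_j `|A i j| ^+ 2 = \tr (A *m A^t*).
  apply: eq_bigr => i _; rewrite mxE; apply: eq_bigr => j _.
  by rewrite normCK !mxE.
rewrite {1 2}spectralA invmx_unitary ?spectral_unitarymx //.
set U := spectralmx A; set D := diag_mx _.
rewrite !trmx_mul !map_mxM trmxCK !mulmxA mulmxtVK ?spectral_unitarymx //.
rewrite -!mulmxA mxtrace_mulC -!mulmxA.
rewrite [U *m U^t*](unitarymxP _) ?spectral_unitarymx // mulmx1.
rewrite tr_diag_mx map_diag_mx mulmx_diag mxtrace_diag.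
by apply: eq_bigr => i _; rewrite !mxE normCK.
Qed.

Lemma mx_energy_ge0 : 0 <= mx_energy A.
Proof. by rewrite mx_energy_normal sumr_ge0. Qed.

Lemma sqr_mx_energy_le :
  mx_energy A ^+ 2 <= n%:R * \sum_i \sum_j `|A i j| ^+ 2.
Proof.
(* After doubling, both sides become double sums over [i] and [j], compared termwise by 2ab <= a^2 +
   b^2. *)
rewrite frobenius_normal mx_energy_normal -(ler_pM2r (ltr0Sn C 1)).
have <- : \sum_i \sum_j (`|d i| ^+ 2 + `|d j| ^+ 2) =
    n%:R * (\sum_i `|d i| ^+ 2) * 2.
  under eq_bigr do rewrite big_split sumr_const card_ord /=.
  rewrite big_split /= sumr_const card_ord sumrMnl -mulr2n.
  by rewrite mulr_natl mulr_natr.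
rewrite expr2 mulr_suml mulr_suml ler_sum // => i _.
rewrite mulr_sumr mulr_suml ler_sum // => j _.
by rewrite mulr_natr real_leif_mean_square_scaled ?normr_real.
Qed.

(* As the eigenvalues sum to 0, each one is minus the sum of the others, so
   that 2|lambda_i| is at most the energy. *)
Lemma sqr_mx_energy_ge : \tr A = 0 ->
  2 * \sum_i \sum_j `|A i j| ^+ 2 <= mx_energy A ^+ 2.
Proof.
rewrite mxtrace_normal frobenius_normal mx_energy_normal => tr0.
rewrite mulr_sumr expr2 mulr_suml ler_sum // => i _.
rewrite expr2 mulrCA ler_wpM2l // mulr_natl mulr2n.
move: tr0; rewrite (bigD1 i) //= => /(canRL (addrK _)); rewrite sub0r => tr0.
by rewrite [leRHS](bigD1 i) //= lerD2l {1}tr0 normrN ler_norm_sum.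
Qed.

End NormalMatrices.

(** * Vertex-disjoint paths: bounds and symmetry *)

Section DisjointPaths.

Variables (T : finType) (e : rel T).
Hypothesis irr_e : irreflexive e.

Lemma max_disjoint_paths_ge (x y : T) : (e x y <= max_disjoint_paths e x y)%N.
Proof.
case exy: (e x y) => //=.
have neq_xy : x != y by apply: contraTneq exy => ->; rewrite irr_e.
have szT : (size [:: y] <= #|T|)%N by apply/card_gt0P; exists y.
rewrite -(cards1 (Bseq szT)); apply: leq_bigmax_cond.
apply/andP; split; apply/forall_inP => s /set1P ->.
  by rewrite /path_between /= exy eqxx inE neq_xy.
by apply/forall_inP => t /set1P ->; rewrite eqxx.
Qed.

(** Since [x != y], [s] is nonempty and [head x s] is the first vertex after [x]. If it is already
    [y], the path must stop there, as continuing would visit [y] twice. *)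
Lemma path_between_head (x y : T) (s : seq T) :
  x != y -> path_between e x y s ->
  [/\ e x (head x s), head x s \in s, head x s != x & head x s = y -> s = [:: y]].
Proof.
move=> neq_xy; case: s => [|z s]; first by rewrite /path_between /= (negPf neq_xy).
case/and3P=> /= /andP[exz _] /eqP last_s /and3P[].
rewrite inE negb_or => /andP[neq_xz _] zs _.
split; rewrite ?inE ?eqxx //; first by rewrite eq_sym.
move=> eq_zy; case: s => [|w s] in last_s zs *; first by rewrite eq_zy.
by case/negP: zs; rewrite eq_zy -last_s /= mem_last.
Qed.

(* Distinct disjoint paths from x leave x through distinct neighbours. *)
Lemma max_disjoint_paths_le (x y : T) : x != y ->
  (max_disjoint_paths e x y <= degree e x)%N.
Proof.
move=> neq_xy; apply/bigmax_leqP => F /andP[/forall_inP pathF /forall_inP disjF].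
rewrite -(card_in_imset (f := fun s : #|T|.-bseq T => head x s)).
  apply/subset_leq_card/subsetP => _ /imsetP[s Fs ->]; rewrite inE.
  by have [] := path_between_head neq_xy (pathF s Fs).
move=> s t Fs Ft /= eq_hd; apply/eqP; apply: contraT => neq_st.
have [_ hs hsx hsy] := path_between_head neq_xy (pathF s Fs).
have [_ ht _ hty] := path_between_head neq_xy (pathF t Ft).
(* By disjointness a common first vertex is [x] or [y]. It is not [x], and if it is [y] then both
   paths are the single edge. *)
have /forall_inP/(_ t Ft)/implyP/(_ neq_st)/forallP/(_ (head x s)) := disjF s Fs.
rewrite inE hs inE eq_hd ht !orbT /= -eq_hd !inE (negPf hsx) /= => /eqP hs_y.
by case/eqP: neq_st; apply: val_inj; rewrite /= hsy // hty // -eq_hd.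
Qed.

Hypothesis sym_e : symmetric e.

(** A path is stored without its starting vertex, so its reversal drops [y] and ends with [x],
    whence [belast]. *)
Lemma path_between_rev (x y : T) (s : seq T) : path_between e x y s ->
  y :: rev (belast x s) = rev (x :: s) /\ path_between e y x (rev (belast x s)).
Proof.
case/and3P=> e_s /eqP last_s uniq_s.
have rev_s : y :: rev (belast x s) = rev (x :: s).
  by rewrite [in RHS]lastI rev_rcons last_s.
split=> //; apply/and3P; split; last by rewrite rev_s rev_uniq.
  rewrite -last_s rev_path; apply: sub_path e_s => u v /=.
  by rewrite sym_e.
by rewrite -(last_cons y) rev_s rev_cons last_rcons.
Qed.

Let bseq_rev_belast (x : T) (s : #|T|.-bseq T) : #|T|.-bseq T :=
  insub_bseq _ (rev (belast x s)).

(** Reversal sends a disjoint family from [x] to [y] injectively to one from [y] to [x], since paths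
    keep their vertex sets. *)
Lemma max_disjoint_paths_sym (x y : T) :
  max_disjoint_paths e x y = max_disjoint_paths e y x.
Proof.
suff le x' y' : (max_disjoint_paths e x' y' <= max_disjoint_paths e y' x')%N.
  by apply/eqP; rewrite eqn_leq !le.
move: x' y' => {}x {}y.
apply/bigmax_leqP => F /andP[/forall_inP pathF /forall_inP disjF].
(* Reversal preserves the length, so [insub_bseq] never falls back on its default value. *)
have valf s : val (bseq_rev_belast x s) = rev (belast x s).
  rewrite /bseq_rev_belast /insub_bseq val_insubd size_rev size_belast.
  by rewrite size_bseq.
have injf : {in F &, injective (bseq_rev_belast x)}.
  move=> s t Fs Ft /(congr1 val); rewrite !valf => eq_st; apply: val_inj.
  have [rev_s _] := path_between_rev (pathF s Fs).
  have [rev_t _] := path_between_rev (pathF t Ft).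
  by have /(can_inj revK)[] : rev (x :: s) = rev (x :: t) by rewrite -rev_s -rev_t eq_st.
rewrite -(card_in_imset injf); apply: leq_bigmax_cond; apply/andP; split.
  apply/forall_inP => _ /imsetP[s Fs ->]; rewrite valf.
  by have [] := path_between_rev (pathF s Fs).
apply/forall_inP => _ /imsetP[s Fs ->]; apply/forall_inP => _ /imsetP[t Ft ->].
apply/implyP => neq_st; apply/forallP => z; rewrite !valf.
have [-> _] := path_between_rev (pathF s Fs).
have [-> _] := path_between_rev (pathF t Ft).
have /forall_inP/(_ t Ft)/implyP := disjF s Fs.
have neq_st' : s != t by apply: contraNneq neq_st => ->.
move=> /(_ neq_st')/forallP/(_ z); rewrite !mem_rev !(inE, mem_seq2).
by rewrite [(z == y) || _]orbC.
Qed.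

End DisjointPaths.

(** * Adjacency and path matrices, and their energies *)

Lemma real_symmetric_normalmx (C : numClosedFieldType) n (A : 'M[C]_n) :
  (forall i j, A i j \is Num.real) -> (forall i j, A i j = A j i) ->
  A \is normalmx.
Proof.
move=> realA symA; apply: symmetric_normalmx; last exact/mxOverP.
apply/is_hermitianmxP; rewrite scale1r map_mx_id //.
by apply/matrixP => i j; rewrite mxE symA.
Qed.


Section GraphMatrices.

Variables (C : numClosedFieldType) (T : finType) (e : rel T).
Hypothesis simple_e : simple_graph e.

Local Notation A := (adjacency_mx e C).
Local Notation P := (path_mx e C).
Local Notation p := (#|T|%:R : C).
Local Notation Delta := ((max_degree e)%:R : C).

Lemma adjacency_mx_normal : A \is normalmx.
Proof.
have [sym_e _] := simple_e.
by apply: real_symmetric_normalmx => i j; rewrite !mxE ?realn // sym_e.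
Qed.

Lemma path_mx_normal : P \is normalmx.
Proof.
have [sym_e _] := simple_e.
apply: real_symmetric_normalmx => i j; rewrite !mxE ?realn //.
by rewrite eq_sym max_disjoint_paths_sym.
Qed.

Lemma mxtrace_path_mx : \tr P = 0.
Proof. by apply: big1 => i _; rewrite mxE eqxx. Qed.

Lemma adjacency_mx_le_path_mx i j : A i j <= P i j.
Proof.
have [_ irr_e] := simple_e; rewrite !mxE ler_nat.
by have [->|_] := eqVneq; [rewrite irr_e | exact: max_disjoint_paths_ge].
Qed.

Lemma path_mx_le_max_degree i j : i != j -> P i j <= Delta.
Proof.
move=> neq_ij; rewrite mxE (negPf neq_ij) ler_nat.
apply: leq_trans (leq_bigmax (enum_val i)); apply: max_disjoint_paths_le.
by apply: contraNneq neq_ij => /enum_val_inj ->.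
Qed.

Lemma frobenius_adjacency_le_path :
  \sum_i \sum_j `|A i j| ^+ 2 <= \sum_i \sum_j `|P i j| ^+ 2.
Proof.
apply: ler_sum => i _; apply: ler_sum => j _.
have A_ge0 : 0 <= A i j by rewrite mxE ler0n.
have le_AP := adjacency_mx_le_path_mx i j.
by rewrite lerXn2r ?nnegrE // !ger0_norm // (le_trans A_ge0).
Qed.

Lemma frobenius_path_mx_le :
  \sum_i \sum_j `|P i j| ^+ 2 <= p * (p - 1) * Delta ^+ 2.
Proof.
have -> : p * (p - 1) * Delta ^+ 2 = \sum_(i < #|T|) \sum_(j | j != i) Delta ^+ 2.
  under eq_bigr => i _.
    rewrite sumr_const (_ : #|_| = #|T|.-1); last first.
      by rewrite cardC1 card_ord.
    over.
  rewrite sumr_const card_ord -mulrnA -[RHS]mulr_natr natrM.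
  (* The predecessor is truncated at 0, so the empty graph is treated apart. *)
  by case: #|T| => [|k] /=; rewrite ?mul0r ?mulr0 // -natr1; ring.
apply: ler_sum => i _; rewrite (bigD1 i) //= [P i i]mxE eqxx normr0 expr0n add0r.
apply: ler_sum => j neq_ji; rewrite lerXn2r ?nnegrE ?ler0n //.
rewrite ger0_norm; first by rewrite path_mx_le_max_degree // eq_sym.
by rewrite mxE ler0n.
Qed.

Lemma graph_energy_ge0 : 0 <= graph_energy e C.
Proof. exact/mx_energy_ge0/adjacency_mx_normal. Qed.

Lemma path_energy_ge0 : 0 <= path_energy e C.
Proof. exact/mx_energy_ge0/path_mx_normal. Qed.

Lemma sqr_graph_energy_le : graph_energy e C ^+ 2 *+ 2 <= p * path_energy e C ^+ 2.
Proof.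
apply: le_trans (ler_wpM2l (ler0n _ _) (sqr_mx_energy_ge path_mx_normal mxtrace_path_mx)).
rewrite mulrCA mulr_natl lerMn2r /=.
apply: le_trans (sqr_mx_energy_le adjacency_mx_normal) _.
by rewrite ler_wpM2l ?ler0n // frobenius_adjacency_le_path.
Qed.

Lemma sqr_path_energy_le : path_energy e C ^+ 2 <= p ^+ 2 * (p - 1) * Delta ^+ 2.
Proof.
apply: le_trans (sqr_mx_energy_le path_mx_normal) _.
by rewrite expr2 -!mulrA ler_wpM2l ?ler0n // mulrA frobenius_path_mx_le.
Qed.

Lemma graph_energy_le : graph_energy e C <= p / 2 * path_energy e C.
Proof.
rewrite -ler_sqr ?nnegrE ?graph_energy_ge0 ?mulr_ge0 ?invr_ge0 ?ler0n //; last first.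
  exact: path_energy_ge0.
have PE2_ge0 : 0 <= path_energy e C ^+ 2 by rewrite exprn_ge0 ?path_energy_ge0.
have le_E2 := sqr_graph_energy_le.
(* For p <= 1 the bound p^2 (p - 1) Delta^2 on the squared path energy vanishes, which forces both
   energies to be 0. *)
have [p_le1|p_gt1] := leqP #|T| 1.
  have PE2_0 : path_energy e C ^+ 2 = 0.
    apply: le_anti; rewrite PE2_ge0 andbT (le_trans sqr_path_energy_le) //.
    by case: #|T| p_le1 => [|[|]] // _; rewrite ?subrr ?mulr0 ?mul0r // expr0n !mul0r.
  by move: le_E2; rewrite exprMn PE2_0 !mulr0 pmulrn_lle0.
(* Clearing the denominator 4 leaves a comparison of 2 p PE^2 with p^2 PE^2, where 2 <= p is
   used. *)
rewrite -(ler_pM2r (ltr0Sn C 3)).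
have -> : (p / 2 * path_energy e C) ^+ 2 * 4 = p * (p * path_energy e C ^+ 2).
  by field.
apply: le_trans (_ : 2 * (p * path_energy e C ^+ 2) <= _); last first.
  by rewrite ler_wpM2r ?ler_nat // mulr_ge0 ?ler0n.
have -> : graph_energy e C ^+ 2 * 4 = 2 * (graph_energy e C ^+ 2 *+ 2) by ring.
by rewrite ler_wpM2l ?ler0n.
Qed.

Lemma path_energy_le : path_energy e C <= p * (p - 1) * Delta.
Proof.
(* In the field, p - 1 is negative when p = 0; the factor p rescues the sign. *)
have p1_ge0 : 0 <= p * (p - 1).
  by case: #|T| => [|k]; rewrite ?mul0r // -natr1 addrK mulr_ge0 ?ler0n ?addr_ge0.
rewrite -ler_sqr ?nnegrE ?path_energy_ge0 ?(mulr_ge0 p1_ge0) ?ler0n //.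
apply: le_trans sqr_path_energy_le _.
rewrite !exprMn ler_wpM2r ?exprn_ge0 ?ler0n //.
(* What remains is p^2 (p - 1) <= p^2 (p - 1)^2: both sides are 0 for p <= 1, and otherwise p - 1 >=
   1. *)
case: #|T| => [|[|k]]; rewrite ?expr0n ?mul0r ?subrr ?expr0n ?mulr0 //=.
rewrite ler_wpM2l ?exprn_ge0 ?ler0n // -natr1 addrK.
by rewrite ler_eXnr // ler1n.
Qed.

End GraphMatrices.

Theorem corollary2p5 (C : numClosedFieldType) (T : finType) (e : rel T)
    (simple_e : simple_graph e) (connected_e : connected_graph e) :
  let p : C := #|T|%:R in
  let E : C := graph_energy e C in
  let PE : C := path_energy e C in
  let Delta : C := (max_degree e)%:R in
  (E <= p / 2 * PE /\ p / 2 * PE <= p ^+ 2 * (p - 1) * Delta / 2) /\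
  (is_K2 e ->
     E = p / 2 * PE /\ p / 2 * PE = p ^+ 2 * (p - 1) * Delta / 2).
Proof.
move=> p E PE Delta.
have le_E : E <= p / 2 * PE by exact: graph_energy_le.
have le_PE : p / 2 * PE <= p ^+ 2 * (p - 1) * Delta / 2.
  have -> : p ^+ 2 * (p - 1) * Delta / 2 = p / 2 * (p * (p - 1) * Delta) by ring.
  by rewrite ler_wpM2l ?divr_ge0 ?ler0n ?path_energy_le.
split=> // -[p2 e_K2].
(* For K2 the values are pinned by the chain 2 <= E <= PE <= 2, with p = 2 and Delta = 1. *)
have degree_K2 x : degree e x = 1%N.
  have -> : degree e x = #|[set~ x]|.
    by apply: eq_card => y; rewrite !inE e_K2 eq_sym.
  by rewrite cardsC1 p2.
have Delta1 : (max_degree e <= 1)%N.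
  by apply/bigmax_leqP => x _; rewrite degree_K2.
have p_2 : p = 2 by rewrite /p p2.
have le_E_PE : E <= PE by move: le_E; rewrite p_2 divff ?pnatr_eq0 // mul1r.
have PE_le2 : PE <= 2.
  apply: le_trans (path_energy_le C simple_e) _.
  rewrite -[#|T|%:R]/p p_2 -[X in _ * X]/Delta.
  have -> : (2 * (2 - 1) * Delta : C) = 2 * Delta by ring.
  by rewrite -[leRHS]mulr1 ler_wpM2l ?ler0n ?lern1.
(* The adjacency matrix also has trace 0, so E^2 is at least twice its squared Frobenius norm, that
   is 2 * 2. *)
have E_ge2 : 2 <= E.
  rewrite -ler_sqr ?nnegrE ?ler0n ?graph_energy_ge0 //.
  have [_ irr_e] := simple_e.
  have trA : \tr (adjacency_mx e C) = 0 by apply: big1 => i _; rewrite mxE irr_e.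
  apply: le_trans (sqr_mx_energy_ge (adjacency_mx_normal C simple_e) trA).
  rewrite expr2 ler_wpM2l ?ler0n //.
  (* The entries are 0 or 1, so a row of squares sums to the degree of its vertex. *)
  have row_sum i : \sum_j `|adjacency_mx e C i j| ^+ 2 = 1.
    have -> : 1 = (degree e (enum_val i))%:R :> C by rewrite degree_K2.
    rewrite /degree -sum1_card natr_sum big_mkcond [RHS]big_mkcond.
    rewrite (reindex (@enum_val T T)) /=; last exact: onW_bij (@enum_val_bij T).
    apply: eq_bigr => j _; rewrite mxE !inE /=.
    by case: (e _ _); rewrite ?normr1 ?expr1n ?normr0 ?expr0n.
  by under eq_bigr do rewrite row_sum; rewrite sumr_const card_ord p2.
have eq_E : E = 2 by apply: le_anti; rewrite E_ge2 (le_trans le_E_PE).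
have eq_PE : PE = 2 by apply: le_anti; rewrite PE_le2 -eq_E.
(* The lower bound needs some vertex; [p2] supplies the one of index 0. *)
have eq_Delta : Delta = 1.
  apply: le_anti; rewrite lern1 Delta1 ler1n -(degree_K2 (enum_val (cast_ord (esym p2) ord0))).
  exact: leq_bigmax.
by rewrite eq_E eq_PE eq_Delta p_2; split; field.
Qed.
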